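(* Let $L$ be a profinite lattice. Then the following are equivalent: (a) $L$ is join semidistributive; (b) $L$ is completely join semidistributive; (c) for every cofinite congruence $\equiv$ on $L$, the quotient lattice $L/{\equiv}$ is join semidistributive; (d) every widely generated element of $L$ has a canonical join representation; (e) every finitely generated element of $L$ has a canonical join representation.
   Context: A complete lattice congruence on a complete lattice $L$ is an equivalence relation $\equiv$ such that $x_i\equiv y_i$ for all $i\in I$ ($I$ any index set) implies $\bigvee_i x_i\equiv\bigvee_i y_i$ and $\bigwedge_i x_i\equiv\bigwedge_i y_i$; the quotient lattice $L/{\equiv}$ is the set of equivalence classes with the induced order. A cofinite congruence is a complete lattice congruence with $L/{\equiv}$ finite. A complete lattice $L$ is profinite if for all $x\neq y$ in $L$ there is a cofinite congruence $\equiv$ on $L$ with $x\not\equiv y$. $L$ is completely join semidistributive if for all $y,z\in L$ and every nonempty $X\subseteq L$ with $x\vee y=z$ for all $x\in X$, one has $(\bigwedge X)\vee y=z$. $L$ is join semidistributive if this holds for every nonempty finite $X$. An element $x$ of a poset is widely generated if for all $y<x$ there is a cover relation $x'\lessdot x$ with $y\le x'$. For a complete lattice congruence $\equiv$, each class has a minimum, and $\pi^{\downarrow}_{\equiv}(x)$ denotes the minimum of the class of $x$; an element $x\in L$ is finitely generated if $x=\pi^{\downarrow}_{\equiv}(x)$ for some cofinite congruence $\equiv$ on $L$. For $U,V\subseteq L$ write $U\ll V$ if every $u\in U$ satisfies $u\le v$ for some $v\in V$. A join representation $x=\bigvee U$ is irredundant if no proper subset $U'\subsetneq U$ has $\bigvee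 U'=x$. It is the canonical join representation of $x$ if it is irredundant and $U\ll V$ for every $V\subseteq L$ with $\bigvee V=x$. *)

(* Defs.v *)
From HB Require Import structures.
From mathcomp Require Import all_boot all_order.
From mathcomp Require Import all_classical.

Set Implicit Arguments.
Unset Strict Implicit.
Unset Printing Implicit Defensive.

Import Order.TTheory.

Local Open Scope classical_set_scope.
Local Open Scope quotient_scope.
Local Open Scope order_scope.

HB.mixin Record TBLattice_isComplete (d : Order.disp_t) T
    of Order.TBLattice d T := {
  csup : set T -> T;
  cinf : set T -> T;
  csup_supremums : forall A : set T, supremums A (csup A);
  cinf_infimums : forall A : set T, infimums A (cinf A);
}.

#[short(type="completeLatticeType")]
HB.structure Definition CompleteLattice (d : Order.disp_t) :=
  { T of TBLattice_isComplete d T & Order.TBLattice d T }.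

HB.factory Record POrder_isCompleteLattice (d : Order.disp_t) T
    of Order.POrder d T := {
  csup : set T -> T;
  cinf : set T -> T;
  csup_supremums : forall A : set T, supremums A (csup A);
  cinf_infimums : forall A : set T, infimums A (cinf A);
}.

HB.builders Context (d : Order.disp_t) T of POrder_isCompleteLattice d T.

Let meet (x y : T) := cinf [set z | z = x \/ z = y].
Let join (x y : T) := csup [set z | z = x \/ z = y].

Let meetP (x y z : T) : (x <= meet y z) = (x <= y) && (x <= z).
Proof.
have [lb glb] := cinf_infimums [set t | t = y \/ t = z].
apply/idP/andP => [le_x|[xy xz]]; last by apply: glb => t [] ->.
by split; apply: le_trans le_x _; apply: lb; [left|right].
Qed.

Let joinP (x y z : T) : (join x y <= z) = (x <= z) && (y <= z).
Proof.
have [ub lub] := csup_supremums [set t | t = x \/ t = y].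
apply/idP/andP => [le_z|[xz yz]]; last by apply: lub => t [] ->.
by split; apply: le_trans le_z; apply: ub; [left|right].
Qed.

HB.instance Definition _ := @Order.POrder_MeetJoin_isLattice.Build d T
  meet join meetP joinP.

Let bot_le (x : T) : csup set0 <= x.
Proof. by have [_ ] := csup_supremums set0; apply => y []. Qed.

Let le_top (x : T) : x <= cinf set0.
Proof. by have [_ ] := cinf_infimums set0; apply => y []. Qed.

HB.instance Definition _ := @Order.hasBottom.Build d T (csup set0) bot_le.
HB.instance Definition _ := @Order.hasTop.Build d T (cinf set0) le_top.
HB.instance Definition _ := @TBLattice_isComplete.Build d T
  csup cinf csup_supremums cinf_infimums.
HB.end.

Section CompleteLatticeTheory.
Context {d : Order.disp_t} {L : completeLatticeType d}.
Implicit Types (A : set L) (x y : L).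

Lemma csup_ub A x : A x -> x <= csup A.
Proof. by have [ub _] := csup_supremums A; apply: ub. Qed.

Lemma csup_lub A y : (forall x, A x -> x <= y) -> csup A <= y.
Proof. by have [_ lub] := csup_supremums A; apply: lub. Qed.

Lemma cinf_lb A x : A x -> cinf A <= x.
Proof. by have [lb _] := cinf_infimums A; apply: lb. Qed.

Lemma cinf_glb A y : (forall x, A x -> y <= x) -> y <= cinf A.
Proof. by have [_ glb] := cinf_infimums A; apply: glb. Qed.

End CompleteLatticeTheory.

(* The relation is boolean because equiv_rel is; under the classical axioms of
   boolp this is no restriction. *)
Record complete_congruence (d : Order.disp_t) (L : completeLatticeType d) :=
  CompleteCongruence {
    congr_rel :> equiv_rel L;
    congr_csup : forall (I : Type) (x y : I -> L),
      (forall i, congr_rel (x i) (y i)) ->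
      congr_rel (csup (range x)) (csup (range y));
    congr_cinf : forall (I : Type) (x y : I -> L),
      (forall i, congr_rel (x i) (y i)) ->
      congr_rel (cinf (range x)) (cinf (range y))
  }.

Definition quotient (d : Order.disp_t) (L : completeLatticeType d)
  (c : complete_congruence L) := {eq_quot c}.

Section Quotient.
Context {d : Order.disp_t} {L : completeLatticeType d}.
Variable c : complete_congruence L.
Local Notation Q := (quotient c).
Implicit Types (a b x y z : L) (p q r : Q).

HB.instance Definition _ := Choice.on Q.
HB.instance Definition _ := EqQuotient.on Q.

Lemma quotient_eqP x y : \pi_Q x = \pi_Q y <-> c x y.
Proof. by split=> [/eqmodP|? ]; last exact/eqmodP. Qed.

Lemma congr_join a b x y : c a b -> c x y -> c (a `|` x) (b `|` y).
Proof.
move=> ab xy.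
have E u v : u `|` v = csup (range (fun i : bool => if i then u else v)).
  apply/le_anti/andP; split; last first.
    by apply: csup_lub => _ [[] _ <-]; rewrite ?leUl ?leUr.
  by rewrite leUx; apply/andP; split; apply: csup_ub; [exists true|exists false].
by rewrite !E; apply: congr_csup => -[].
Qed.

Lemma congr_meet a b x y : c a b -> c x y -> c (a `&` x) (b `&` y).
Proof.
move=> ab xy.
have E u v : u `&` v = cinf (range (fun i : bool => if i then u else v)).
  apply/le_anti/andP; split.
    by apply: cinf_glb => _ [[] _ <-]; rewrite ?leIl ?leIr.
  by rewrite lexI; apply/andP; split; apply: cinf_lb; [exists true|exists false].
by rewrite !E; apply: congr_cinf => -[].
Qed.

(* A class is below another when some representatives are comparable in L; for
   a lattice congruence this is the order of the quotient lattice. *)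
Definition quotient_le p q : bool :=
  `[< exists x y, [/\ \pi_Q x = p, \pi_Q y = q & x <= y] >].

Lemma quotient_le_join a b : quotient_le (\pi_Q a) (\pi_Q b) = c (a `|` b) b.
Proof.
apply/asboolP/idP => [[x [y [/quotient_eqP xa /quotient_eqP yb xy]]]|abb].
  have := congr_join xa yb; rewrite (join_r xy) => yab.
  by apply: equiv_trans (yb); rewrite equiv_sym.
by exists a, (a `|` b); split; [|exact/quotient_eqP|exact: leUl].
Qed.

Lemma quotient_le_meet a b : quotient_le (\pi_Q a) (\pi_Q b) = c (a `&` b) a.
Proof.
apply/asboolP/idP => [[x [y [/quotient_eqP xa /quotient_eqP yb xy]]]|aba].
  have := congr_meet xa yb; rewrite (meet_l xy) => xab.
  by apply: equiv_trans (xa); rewrite equiv_sym.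
by exists (a `&` b), b; split; [exact/quotient_eqP| |exact: leIr].
Qed.

Lemma quotient_le_refl : reflexive quotient_le.
Proof. by elim/quotW => x; rewrite quotient_le_join joinxx. Qed.

Lemma quotient_le_anti : antisymmetric quotient_le.
Proof.
elim/quotW => x; elim/quotW => y.
rewrite quotient_le_join quotient_le_meet => /andP[xyy].
rewrite meetC => xyy'; apply/quotient_eqP.
have: quotient_le (\pi_Q x) (\pi_Q y) by rewrite quotient_le_join.
rewrite quotient_le_meet equiv_sym => xxy.
exact: equiv_trans xyy'.
Qed.

Lemma quotient_le_trans : transitive quotient_le.
Proof.
elim/quotW => y; elim/quotW => x; elim/quotW => z.
rewrite !quotient_le_join => xyy yzz.
have h : c (x `|` z) (x `|` (y `|` z)).
  by apply: congr_join; rewrite ?equiv_refl // equiv_sym.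
apply: equiv_trans h _; rewrite joinA.
by apply: equiv_trans yzz; apply: congr_join.
Qed.

HB.instance Definition _ := @Order.Le_isPOrder.Build d Q
  quotient_le quotient_le_refl quotient_le_anti quotient_le_trans.

Lemma le_quotientP p q :
  p <= q <-> exists x y, [/\ \pi_Q x = p, \pi_Q y = q & x <= y].
Proof. by split=> /asboolP. Qed.

Definition quotient_csup (A : set Q) : Q := \pi_Q (csup [set x | A (\pi_Q x)]).
Definition quotient_cinf (A : set Q) : Q := \pi_Q (cinf [set x | A (\pi_Q x)]).

Lemma quotient_csup_supremums (A : set Q) : supremums A (quotient_csup A).
Proof.
split=> [p Ap|r]; last first.
  elim/quotW: r => b ub; rewrite /Order.le /= quotient_le_join.
  set S := [set x | _].
  have := @congr_csup _ _ c (option {x | S x})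
    (fun o => if o is Some i then sval i `|` b else b) (fun=> b).
  have -> : csup (range (fun _ : option {x | S x} => b)) = b.
    apply/le_anti/andP; split; first by apply: csup_lub => _ [_ _ <-].
    by apply: csup_ub; exists None.
  have <- : csup S `|` b = csup (range (fun o : option {x | S x} =>
      if o is Some i then sval i `|` b else b)).
    apply/le_anti/andP; split.
      rewrite leUx; apply/andP; split; last by apply: csup_ub; exists None.
      apply: csup_lub => x Sx; apply: le_trans (leUl x b) _.
      by apply: csup_ub; exists (Some (exist _ x Sx)).
    apply: csup_lub => _ [[[x Sx]|] _ <-] /=; last exact: leUr.
    by apply: leU2; first exact: csup_ub.
  apply => -[[x Sx]|] /=; last exact: equiv_refl.
  by rewrite -quotient_le_join; apply: ub.
elim/quotW: p Ap => x Ax; apply/le_quotientP.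
by exists x, (csup [set x | A (\pi_Q x)]); split => //; apply: csup_ub.
Qed.

Lemma quotient_cinf_infimums (A : set Q) : infimums A (quotient_cinf A).
Proof.
split=> [p Ap|r]; last first.
  elim/quotW: r => b lb; rewrite /Order.le /= quotient_le_meet.
  set S := [set x | _].
  have := @congr_cinf _ _ c (option {x | S x})
    (fun o => if o is Some i then b `&` sval i else b) (fun=> b).
  have -> : cinf (range (fun _ : option {x | S x} => b)) = b.
    apply/le_anti/andP; split; last by apply: cinf_glb => _ [_ _ <-].
    by apply: cinf_lb; exists None.
  have <- : b `&` cinf S = cinf (range (fun o : option {x | S x} =>
      if o is Some i then b `&` sval i else b)).
    apply/le_anti/andP; split.
      apply: cinf_glb => _ [[[x Sx]|] _ <-] /=; last exact: leIl.
      by apply: leI2; last exact: cinf_lb.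
    rewrite lexI; apply/andP; split; first by apply: cinf_lb; exists None.
    apply: cinf_glb => x Sx; apply: le_trans (leIr x b).
    by apply: cinf_lb; exists (Some (exist _ x Sx)).
  apply => -[[x Sx]|] /=; last exact: equiv_refl.
  by rewrite -quotient_le_meet; apply: lb.
elim/quotW: p Ap => x Ax; apply/le_quotientP.
by exists (cinf [set x | A (\pi_Q x)]), x; split => //; apply: cinf_lb.
Qed.

HB.instance Definition _ := @POrder_isCompleteLattice.Build d Q
  quotient_csup quotient_cinf quotient_csup_supremums quotient_cinf_infimums.

End Quotient.

Definition cofinite_congruence (d : Order.disp_t) (L : completeLatticeType d)
  (c : complete_congruence L) : Prop := finite_set [set: quotient c].

Definition profinite (d : Order.disp_t) (L : completeLatticeType d) : Prop :=
  forall x y : L, x <> y ->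
  exists c : complete_congruence L, cofinite_congruence c /\ ~ c x y.

Definition completely_join_semidistributive (d : Order.disp_t)
    (L : completeLatticeType d) : Prop :=
  forall (y z : L) (X : set L), X !=set0 ->
  (forall x, X x -> x `|` y = z) -> cinf X `|` y = z.

Definition join_semidistributive (d : Order.disp_t)
    (L : completeLatticeType d) : Prop :=
  forall (y z : L) (X : set L), finite_set X -> X !=set0 ->
  (forall x, X x -> x `|` y = z) -> cinf X `|` y = z.

Definition covered (d : Order.disp_t) (P : porderType d) (x y : P) : Prop :=
  x < y /\ forall z, ~ (x < z < y).

Definition widely_generated (d : Order.disp_t) (P : porderType d) (x : P)
    : Prop :=
  forall y, y < x -> exists x', covered x' x /\ y <= x'.

(* The minimum of the class of x; see pi_down_min. *)
Definition pi_down (d : Order.disp_t) (L : completeLatticeType d)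
  (c : complete_congruence L) (x : L) : L := cinf [set y | c x y].

Lemma pi_down_min (d : Order.disp_t) (L : completeLatticeType d)
    (c : complete_congruence L) (x : L) :
  c x (pi_down c x) /\ forall y, c x y -> pi_down c x <= y.
Proof.
split=> [|y xy]; last exact: cinf_lb.
have := @congr_cinf _ _ c {y | c x y} (fun=> x) sval (@svalP _ _).
have -> : cinf (range (fun _ : {y | c x y} => x)) = x.
  apply/le_anti/andP; split; last by apply: cinf_glb => _ [_ _ <-].
  by apply: cinf_lb; exists (exist _ x (equiv_refl c x)).
congr (is_true (c x (cinf _))); apply/seteqP; split=> [_ [[y xy] _ <-] //|y xy].
by exists (exist _ y xy).
Qed.

Definition finitely_generated (d : Order.disp_t) (L : completeLatticeType d)
    (x : L) : Prop :=
  exists c : complete_congruence L, cofinite_congruence c /\ x = pi_down c x.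

(* U << V *)
Definition refines (d : Order.disp_t) (P : porderType d) (U V : set P) : Prop :=
  forall u, U u -> exists v, V v /\ u <= v.

Definition irredundant (d : Order.disp_t) (L : completeLatticeType d)
    (U : set L) : Prop :=
  forall U' : set L, (U' `<` U)%classic -> csup U' <> csup U.

Definition canonical_join_representation (d : Order.disp_t)
    (L : completeLatticeType d) (x : L) (U : set L) : Prop :=
  [/\ csup U = x, irredundant U
    & forall V : set L, csup V = x -> refines U V].

(* Main.v *)
(**
All the equivalences go through the finite quotients. If [x \/ y = z] holds in
[L/c] for all [x] in [X], it holds in [L] for suitable representatives: take for
[z] the minimum of its class and meet the other representatives with it.
Hence semidistributivity at the finitely generated elements of [L] passes to the
quotients, and it comes back to [L] because points of [L] are separated by
finite quotients. If [L] is completely join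
semidistributive and [x] is widely generated, the canonical joinands of [x] are
the least solutions [u] of [u \/ x' = x], one for each lower cover [x'] of [x].
Conversely, if [U] is the canonical join representation of [z] and
[x \/ y = z] for all [x] in [X], each element of [U] is below [y] or below
every element of [X], so [z] is the join of [y] and the meet of [X].
*)
Require Import Defs.
From mathcomp Require Import all_boot all_order.
From mathcomp Require Import all_classical.

Set Implicit Arguments.
Unset Strict Implicit.
Unset Printing Implicit Defensive.

Import Order.TTheory.

Local Open Scope classical_set_scope.
Local Open Scope quotient_scope.
Local Open Scope order_scope.

Section QuotientMorphism.
Context {d : Order.disp_t} {L : completeLatticeType d}.
Variable c : complete_congruence L.
Local Notation Q := (quotient c).
Implicit Types (x y z : L) (p q : Q).

Lemma pi_leE x y : (\pi_Q x <= \pi_Q y) = c (x `|` y) y.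
Proof. exact: quotient_le_join. Qed.

Lemma pi_leEmeet x y : (\pi_Q x <= \pi_Q y) = c (x `&` y) x.
Proof. exact: quotient_le_meet. Qed.

Lemma pi_le x y : x <= y -> \pi_Q x <= \pi_Q y.
Proof. by move=> xy; rewrite pi_leE (join_r xy). Qed.

Lemma pi_join x y : \pi_Q (x `|` y) = \pi_Q x `|` \pi_Q y.
Proof.
apply/le_anti/andP; split; last by rewrite leUx !pi_le ?leUl ?leUr.
have [xr yr] : \pi_Q x <= \pi_Q x `|` \pi_Q y /\
               \pi_Q y <= \pi_Q x `|` \pi_Q y by rewrite leUl leUr.
move: (\pi_Q x `|` \pi_Q y) xr yr; elim/quotW => r; rewrite !pi_leE => xr yr.
rewrite -joinA; apply: equiv_trans xr.
by apply: congr_join => //; apply: equiv_refl.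
Qed.

Lemma pi_cinf (A : set L) : \pi_Q (cinf A) = cinf (\pi_Q @` A).
Proof.
apply/le_anti/andP; split.
  by apply: cinf_glb => _ [x Ax <-]; apply: pi_le; apply: cinf_lb.
(* An infimum in the quotient is the class of the infimum of the whole preimage, and this preimage
   contains [A]. *)
change (quotient_cinf (\pi_Q @` A) <= \pi_Q (cinf A)).
by apply: pi_le; apply: cinf_glb => x Ax; apply: cinf_lb; exists x.
Qed.

Lemma pi_downK x : pi_down c (pi_down c x) = pi_down c x.
Proof.
have [xm min_m] := pi_down_min c x.
have [mm' min_m'] := pi_down_min c (pi_down c x).
apply/le_anti/andP; split; first by apply: min_m'; apply: equiv_refl.
by apply: min_m; apply: equiv_trans mm'.
Qed.

Lemma pi_pi_down x : \pi_Q (pi_down c x) = \pi_Q x.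
Proof. by apply/esym/quotient_eqP; case: (pi_down_min c x). Qed.

(** The law is assumed only at minima of classes, so that canonical join representations of finitely
    generated elements suffice to provide it. *)
Lemma quotient_join_semidistributive :
  (forall y z (X : set L), finite_set X -> X !=set0 -> z = pi_down c z ->
     (forall x, X x -> x `|` y = z) -> cinf X `|` y = z) ->
  cofinite_congruence c -> join_semidistributive Q.
Proof.
move=> sd _ y z X finX X0 Xyz.
pose z' := pi_down c (repr z).
have z'K : z' = pi_down c z' by rewrite [RHS]pi_downK.
have piz' : \pi_Q z' = z by rewrite pi_pi_down reprK.
pose g p := repr p `&` z'.
have pig p : p <= z -> \pi_Q (g p) = p.
  move=> pz; rewrite -[RHS](reprK p); apply/quotient_eqP.
  by rewrite -pi_leEmeet reprK piz'.
have yz : y <= z by have [p Xp] := X0; rewrite -(Xyz p Xp) leUr.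
have xz (p : Q) : X p -> p <= z by move=> Xp; rewrite -(Xyz p Xp) leUl.
have gX : \pi_Q @` (g @` X) = X.
  apply/seteqP; split=> [_ [_ [p Xp <-] <-]|p Xp]; first by rewrite pig ?xz.
  by exists (g p); [exists p|rewrite pig ?xz].
have : cinf (g @` X) `|` g y = z'.
  apply: sd => //; first exact: finite_image.
    by have [x Xx] := X0; exists (g x), x.
  move=> _ [p Xp <-]; apply/le_anti/andP; split; first by rewrite leUx !leIr.
  (* The join of [g p] and [g y] lies in the class of [z'], whose minimum is [z']. *)
  have [_ minz'] := pi_down_min c z'.
  rewrite {1}z'K; apply: minz'; apply/quotient_eqP.
  by rewrite pi_join (pig p (xz p Xp)) (pig y yz) Xyz.
by move=> /(congr1 \pi_Q); rewrite pi_join pi_cinf gX pig // piz'.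
Qed.

End QuotientMorphism.

Section Theory.
Context {d : Order.disp_t} {L : completeLatticeType d}.
Implicit Types (x y z : L) (U V X : set L).

(** A finite quotient turns an infinite [X] into a finite set, so the finite law there is enough. *)
Lemma profinite_completely_join_semidistributive :
  profinite L ->
  (forall c : complete_congruence L,
     cofinite_congruence c -> join_semidistributive (quotient c)) ->
  completely_join_semidistributive L.
Proof.
move=> hL sd y z X [x0 Xx0] Xyz; apply: contrapT => /hL[c [cofin]]; apply.
apply/quotient_eqP; rewrite pi_join pi_cinf.
apply: (sd c cofin); first exact: sub_finite_set cofin.
  by exists (\pi_(quotient c) x0), x0.
by move=> _ [x Xx <-]; rewrite -pi_join Xyz.
Qed.

Lemma widely_generated_canonical_join_representation x :
  completely_join_semidistributive L -> widely_generated x ->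
  exists U, canonical_join_representation x U.
Proof.
move=> sd wx.
pose k x' := cinf [set u | u `|` x' = x].
have kx x' : covered x' x -> k x' `|` x' = x.
  move=> [/ltW x'x _]; apply: sd => //; exists x; exact: join_l.
have k_le x' v : covered x' x -> v <= x -> ~~ (v <= x') -> k x' <= v.
  move=> [x'x nox'x] vx vx'; apply: cinf_lb => /=.
  (* As [v] is not below [x'], its join with [x'] is strictly above [x'], hence equal to [x] by the
     cover relation. *)
  have : v `|` x' <= x by rewrite leUx vx ltW.
  rewrite le_eqVlt => /orP[/eqP //|lt_x]; case: (nox'x (v `|` x')).
  by rewrite lt_x andbT lt_def leUr andbT eq_joinr.
have sup_nle x' V : covered x' x -> csup V = x -> exists2 v, V v & ~~ (v <= x').
  move=> [x'x _] Vx; apply: contrapT => noV.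
  have : ~~ (x <= x') by rewrite lt_geF.
  rewrite -Vx; case/negP; apply: csup_lub => v Vv; apply: contrapT => /negP vx'.
  by apply: noV; exists v.
have k_lex x' : covered x' x -> k x' <= x by move=> /kx <-; exact: leUl.
pose U := k @` [set x' | covered x' x].
have supU : csup U = x.
  have : csup U <= x by apply: csup_lub => _ [x' x'x <-]; exact: k_lex.
  (* Otherwise wide generation puts [csup U] under a lower cover [x']; then [k x'] is below [x'],
     and their join cannot be [x]. *)
  rewrite le_eqVlt => /orP[/eqP //|/wx[x' [x'x Ux']]].
  have kx'x' : k x' <= x' by apply: le_trans Ux'; apply: csup_ub; exists x'.
  have := kx x' x'x; rewrite (join_r kx'x') => x'E.
  by case: x'x => + _; rewrite x'E ltxx.
exists U; split=> //; last first.
  move=> V Vx _ [x' x'x <-]; have [v Vv vx'] := sup_nle x' V x'x Vx.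
  by exists v; split=> //; apply: k_le => //; rewrite -Vx csup_ub.
move=> U' [U'U nUU']; rewrite supU => U'x.
apply: nUU' => _ [x' x'x <-].
(* Write [u] as [k x'']. If [x''] differs from [x'], then [x'] is not below [x''], so [k_le] puts
   [k x''] below [x'], against the choice of [u]. *)
have [u U'u /negP ux'] := sup_nle x' U' x'x U'x.
have [x'' x''x uE] := U'U u U'u.
have [<-|x'x''] := pselect (x'' = x'); first by rewrite uE.
case: ux'; rewrite -uE; apply: k_le => //; first by case: x'x => /ltW.
(* Distinct lower covers are incomparable. *)
apply/negP => le_x'x''; case: (x'x) => _ /(_ x''); apply.
case: x''x => -> _; rewrite andbT lt_neqAle le_x'x'' andbT.
by apply/eqP => /esym.
Qed.

Lemma seq_maximal (P : porderType d) (a : P) (s : seq P) :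
  exists2 m, m \in a :: s & forall p, p \in a :: s -> ~~ (m < p).
Proof.
elim: s a => [|b s IHs] a.
  by exists a; rewrite ?mem_head// => p; rewrite inE => /eqP ->; rewrite ltxx.
have [m ms max_m] := IHs b.
have [ma|nma] := boolP (m < a).
  exists a; rewrite ?mem_head// => p; rewrite inE => /orP[/eqP ->|ps].
    by rewrite ltxx.
  by apply: contra (max_m p ps); apply: lt_trans.
exists m; first by rewrite inE ms orbT.
by move=> p; rewrite inE => /orP[/eqP ->|/max_m].
Qed.

Lemma finite_set_maximal (P : porderType d) (A : set P) :
  finite_set A -> A !=set0 -> exists2 m, A m & forall p, A p -> ~~ (m < p).
Proof.
move=> /finite_seqP[[|a s] ->] [p //= _].
by have [m ms max_m] := seq_maximal a s; exists m.
Qed.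

(** Among the elements above [y] and strictly below [x], take one whose class is maximal in the
    finite quotient; the join of all members of that class below [x] is the wanted lower cover. *)
Lemma finitely_generated_widely_generated x :
  finitely_generated x -> widely_generated x.
Proof.
move=> [c [cofin xE]] y yx.
have min_x w : c x w -> x <= w by rewrite {2}xE; apply: (pi_down_min c x).2.
pose below w := y <= w < x.
have [||q [w /andP[yw wx] wq] max_q] :=
    @finite_set_maximal (quotient c) (\pi_(quotient c) @` below).
- exact: sub_finite_set cofin.
- by exists (\pi_(quotient c) y), y => //; rewrite /below lexx.
pose S := [set v | c w v /\ v <= x].
have wS : c w (csup S).
  have := @congr_csup _ _ c {v | S v} (fun=> w) sval (fun v => (svalP v).1).
  have Sw : S w by split; [exact: equiv_refl|exact: ltW].
  have -> : csup (range (fun _ : {v | S v} => w)) = w.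
    apply/le_anti/andP; split; first by apply: csup_lub => _ [_ _ <-].
    by apply: csup_ub; exists (exist _ w Sw).
  congr (is_true (c w (csup _))); apply/seteqP; split.
    by move=> _ [[v Sv] _ <-].
  by move=> v Sv; exists (exist _ v Sv).
have wle : w <= csup S by apply: csup_ub; split; [exact: equiv_refl|exact: ltW].
(* If the join were [x], then [w] would lie in the class of [x], hence above its minimum [x]. *)
have Slt : csup S < x.
  rewrite lt_neqAle; apply/andP; split; last by apply: csup_lub => v [].
  apply/eqP => Sx; move: wS; rewrite Sx equiv_sym => /min_x.
  by rewrite lt_geF.
exists (csup S); split; last exact: le_trans wle.
split=> // v /andP[Sv vx].
(* The class of [v] is at or above [q], hence equal to it by maximality; so [v] is in [S] and below
   its join. *)
have /max_q : (\pi_(quotient c) @` below) (\pi v).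
  by exists v => //; rewrite /below vx (le_trans yw) // (le_trans wle) ?ltW.
have : q <= \pi_(quotient c) v.
  by rewrite -wq; apply: pi_le; apply: le_trans wle (ltW Sv).
rewrite le_eqVlt => /orP[/eqP qv _|-> //].
have : v <= csup S.
  by apply: csup_ub; split; [apply/quotient_eqP; rewrite wq|exact: ltW].
by rewrite lt_geF.
Qed.

Lemma canonical_join_representation_semidistributive y z X U :
  canonical_join_representation z U -> X !=set0 ->
  (forall x, X x -> x `|` y = z) -> cinf X `|` y = z.
Proof.
move=> [supU _ canU] [x0 Xx0] Xyz; apply/le_anti/andP; split.
  by rewrite -(Xyz x0 Xx0) leU2 // cinf_lb.
rewrite -{1}supU; apply: csup_lub => u Uu.
have [uy|nuy] := boolP (u <= y); first exact: le_trans (leUr _ _).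
apply: le_trans (leUl _ _); apply: cinf_glb => x Xx.
(* The pair [x], [y] is a join representation of [z], so [u] is below one of the two. *)
have : csup [set v | v = x \/ v = y] = z.
  rewrite -(Xyz x Xx); apply/le_anti/andP; split.
    by apply: csup_lub => _ [] ->; rewrite ?leUl ?leUr.
  by rewrite leUx; apply/andP; split; apply: csup_ub; [left|right].
move=> /canU/(_ u Uu)[v [[] -> //]].
by rewrite (negPf nuy).
Qed.

End Theory.

Theorem proposition5p15 (d : Order.disp_t) (L : completeLatticeType d)
    (hL : profinite L) :
  [<-> join_semidistributive L;
       completely_join_semidistributive L;
       forall c : complete_congruence L,
         cofinite_congruence c -> join_semidistributive (quotient c);
       forall x : L, widely_generated x ->
         exists U : set L, canonical_join_representation x U;
       forall x : L, finitely_generated x ->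
         exists U : set L, canonical_join_representation x U].
Proof.
have c_b := profinite_completely_join_semidistributive hL.
have b_a : completely_join_semidistributive L -> join_semidistributive L.
  by move=> sd y z X _; apply: sd.
have a_c : join_semidistributive L -> forall c : complete_congruence L,
    cofinite_congruence c -> join_semidistributive (quotient c).
  move=> sd c; apply: quotient_join_semidistributive => y z X finX X0 _.
  exact: sd.
tfae.
- by move=> /a_c/c_b.
- by move=> /b_a/a_c.
- move=> /c_b sd x; exact: widely_generated_canonical_join_representation.
- by move=> cjr x /finitely_generated_widely_generated/cjr.
- move=> cjr; apply/b_a/c_b => c cofin.
  apply: quotient_join_semidistributive (cofin) => y z X _ X0 zE.
  have [|U Uz] := cjr z; first by exists c.
  exact: canonical_join_representation_semidistributive Uz X0.
Qed.
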